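(* Let $\mathcal{A}$ be an irreducible linear switching system in $\mathbb{R}^d$. If $M$ is an eigenset of $\mathcal{A}$ with eigenvalue $\alpha$, then $\alpha=\sigma(\mathcal{A})$, where $\sigma(\mathcal{A})$ is the Lyapunov exponent of $\mathcal{A}$.
   Context: A linear switching system in $\mathbb{R}^d$ is identified with its control set $\mathcal{A}$, a nonempty compact set of real $d\times d$ matrices. A switching law is a measurable function $A(\cdot):[0,\infty)\to\mathcal{A}$. A trajectory is an absolutely continuous function $x:[0,\infty)\to\mathbb{R}^d$ such that, for some switching law, $\dot x(t)=A(t)x(t)$ for almost every $t$. Standing assumption: $\mathcal{A}$ is convex and does not contain the zero matrix. For a compact set $M\subset\mathbb{R}^d$ and $t\ge 0$, $M_t$ denotes the set of points $x(t)$ over all trajectories with $x(0)\in M$ (if $\mathcal A$ is not convex, the closure of this set). An eigenset of $\mathcal{A}$ is a compact set $M\subset\mathbb{R}^d$, $M\neq\emptyset$, $M\ne\{0\}$, for which there is a constant $\alpha\in\mathbb{R}$ with $M_t=e^{\alpha t}M$ for all $t\ge 0$; $\alpha$ is then called an eigenvalue of $\mathcal{A}$ (the eigenvalue of $M$). The Lyapunov exponent $\sigma(\mathcal{A})$ is the infimum of all $\beta\in\mathbb{R}$ such that every trajectory satisfies $\|x(t)\|\le C e^{\beta t}$ for all $t\ge0$ with a constant $C$ depending on the trajectory. The system is irreducible if the matrices of $\mathcal{A}$ have no common invariant linear subspace other than $\{0\}$ and $\mathbb{R}^d$. *)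

(* Defs.v *)
From HB Require Import structures.
From mathcomp Require Import all_boot all_order all_algebra.
From mathcomp Require Import all_classical all_reals all_analysis.
Set Implicit Arguments.
Unset Strict Implicit.
Unset Printing Implicit Defensive.
Import Order.TTheory GRing.Theory Num.Theory.
Import numFieldNormedType.Exports.
Local Open Scope classical_set_scope.
Local Open Scope ring_scope.

Definition switching_system (R : realType) (d : nat) (cA : set 'M[R]_d) : Prop :=
  [/\ cA !=set0,
      compact cA,
      convex_set (cA : set (convex_lmodType 'M[R]_d)) &
      ~ cA 0].

(* Measurability is with respect to the Borel sigma-algebras of R and 'M_d.
   Lebesgue-measurable laws would give the same trajectories, since changing a
   law on a null set does not affect an equation that holds almost everywhere.
   Values of A at negative times are irrelevant. *)
Definition switching_law (R : realType) (d : nat) (cA : set 'M[R]_d)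
    (A : R -> 'M[R]_d) : Prop :=
  measurable_fun (`[0, +oo[ : set (measurableTypeR R))
    (A : measurableTypeR R -> g_sigma_algebraType (@open 'M[R]_d)) /\
  forall t, 0 <= t -> cA (A t).

Definition absolutely_continuous_on (R : realType) (d : nat) (a b : R)
    (f : R -> 'cV[R]_d) : Prop :=
  forall e : R, 0 < e -> exists2 delta : R, 0 < delta &
    forall (n : nat) (u v : 'I_n -> R),
      (forall i, [/\ a <= u i, u i <= v i & v i <= b]) ->
      trivIset setT (fun i => `]u i, v i[%classic) ->
      \sum_i (v i - u i) < delta ->
      \sum_i `|f (v i) - f (u i)| < e.

(* Absolute continuity on the half-line is understood on compact subintervals,
   as usual for Caratheodory solutions. The values of x at negative times are
   irrelevant: they could only affect the two-sided derivative at t = 0, and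
   {0} is a null set. *)
Definition trajectory (R : realType) (d : nat) (cA : set 'M[R]_d)
    (x : R -> 'cV[R]_d) : Prop :=
  (forall T : R, 0 <= T -> absolutely_continuous_on 0 T x) /\
  exists2 A : R -> 'M[R]_d, switching_law cA A &
    {ae (@lebesgue_measure R), forall t, 0 <= t ->
      is_derive (t : R) (1 : R) x (A t *m x t)}.

(* The set of points x(t); it is taken without closure, which is the right
   notion for convex cA. *)
Definition reachable (R : realType) (d : nat) (cA : set 'M[R]_d)
    (M : set 'cV[R]_d) (t : R) : set 'cV[R]_d :=
  [set y | exists x, [/\ trajectory cA x, M (x 0) & x t = y]].

Definition eigenset (R : realType) (d : nat) (cA : set 'M[R]_d)
    (M : set 'cV[R]_d) (alpha : R) : Prop :=
  [/\ compact M, M !=set0, M <> [set 0] &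
      forall t, 0 <= t ->
        reachable cA M t = [set expR (alpha * t) *: y | y in M]].

(* `|x t| is the max-norm; by equivalence of norms, and since C is arbitrary,
   the choice of norm is immaterial. The infimum is taken in \bar R so that it
   carries no junk value when the set is empty or unbounded below. *)
Definition lyapunov_exponent (R : realType) (d : nat) (cA : set 'M[R]_d) :
    \bar R :=
  ereal_inf [set beta%:E | beta in
    [set beta : R | forall x, trajectory cA x ->
      exists C : R, forall t, 0 <= t -> `|x t| <= C * expR (beta * t)]].

Definition irreducible_system (R : realType) (d : nat) (cA : set 'M[R]_d) :
    Prop :=
  forall V : {vspace 'cV[R]_d},
    (forall A, cA A -> forall v, v \in V -> A *m v \in V) ->
    V = 0%VS \/ V = fullv.

(* Main.v *)
(* For a fixed switching law the equation has a unique solution from every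
   initial point, depending linearly on that point. By irreducibility an eigenset
   M contains a basis: its span is invariant because the velocity at time 0 of a
   trajectory that stays in a subspace lies in that subspace. Trajectories from M
   are O(exp(alpha t)), hence by linearity so are all of them, which gives
   sigma <= alpha.

   Conversely, let beta < alpha. A nonzero m in M satisfies: exp(alpha t) m is
   the endpoint of a trajectory of length t issued from M. By irreducibility the
   points attainable from any v <> 0 contain a basis, so some trajectory from v
   first reaches a basis vector and then grows like exp(alpha t). Repeating this
   with longer and longer pieces (a gliding hump) produces one trajectory which is
   not O(exp(beta t)). *)
Require Import Defs.
From HB Require Import structures.
From mathcomp Require Import all_boot all_order all_algebra.
From mathcomp Require Import all_classical all_reals all_analysis.
From mathcomp Require Import measurable_realfun ring lra.
Set Implicit Arguments.
Unset Strict Implicit.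
Unset Printing Implicit Defensive.
Import Order.TTheory GRing.Theory Num.Theory.
Import numFieldNormedType.Exports.
Local Open Scope classical_set_scope.
Local Open Scope ring_scope.

(** * Growth of absolutely continuous functions *)

(** With the difference quotient cleared, the estimate includes [s = t] and can be combined on the
    two sides of [t]. *)
Lemma is_derive_epsP (R : realType) (W : normedModType R) (f : R -> W) (t : R)
    (l : W) :
  is_derive t (1 : R) f l <->
  forall e, 0 < e -> exists2 r, 0 < r &
    forall s, `|s - t| < r -> `|f s - f t - (s - t) *: l| <= e * `|s - t|.
Proof.
split.
- move=> [df dl] e e0.
  have : (fun h : R => h^-1 *: (f (h *: (1 : R) + t) - f t)) @ 0^' --> l.
    by rewrite -dl; exact: df.
  move/cvgrPdist_le => /(_ _ e0) [r /= r0 hr].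
  exists r => // s st.
  have [->|sNt] := eqVneq s t; first by rewrite !subrr scale0r subrr !normr0 mulr0.
  have st0 : s - t != 0 by rewrite subr_eq0.
  have := hr (s - t); rewrite /ball_ /= sub0r normrN => /(_ st st0).
  rewrite [(s - t) *: 1]mulr1 subrK distrC => H.
  rewrite -[f s - f t](scalerKV st0) -scalerBr normrZ mulrC.
  by rewrite ler_wpM2r.
- move=> H.
  have cv : (fun h : R => h^-1 *: (f (h *: (1 : R) + t) - f t)) @ 0^' --> l.
    apply/cvgrPdist_le => e e0; have [r r0 hr] := H _ e0.
    exists r => //= h; rewrite /ball_ /= sub0r normrN => hlt h0.
    have := hr (h + t); rewrite addrK => /(_ hlt) H1.
    rewrite [h *: 1]mulr1 distrC.
    rewrite -[l](scalerK h0) -scalerBr normrZ normfV.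
    by rewrite ler_pdivrMl ?normr_gt0// mulrC.
  split; first by apply/cvg_ex; exists l.
  exact/cvg_lim.
Qed.

(** A step carries [Q] across [t], from a point on its left to one on its right. Applied at the
    supremum of the times where [Q] holds, it passes beyond that supremum unless the latter equals
    [b]. *)
Lemma real_induction (R : realType) (a b : R) (Q : R -> Prop) :
  a <= b -> Q a ->
  (forall t, a <= t <= b -> exists2 r, 0 < r &
    forall s s', a <= s <= t -> t <= s' <= b -> t - r < s -> s' < t + r ->
      Q s -> Q s') ->
  Q b.
Proof.
move=> ab Qa step.
pose S := [set s | a <= s <= b /\ Q s].
have Sa : S a by split => //; rewrite lexx.
have supS : has_sup S by split; [exists a|exists b => s [/andP[]]].
have ac : a <= sup S by exact: sup_upper_bound.
have cb : sup S <= b by apply: ge_sup => [|s [/andP[]]//]; exists a.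
have [r r0 hr] := step (sup S) ltac:(by rewrite ac cb).
have [s [/andP[as_ sb] Qs] src] := sup_adherent r0 supS.
have sc : s <= sup S by apply: sup_upper_bound => //; split => //; rewrite as_.
have [cltb|] := ltP (sup S) b; last first.
  move=> bc; apply: (hr s b); rewrite ?as_ ?lexx ?andbT//.
  by apply: le_lt_trans bc _; rewrite ltrDl.
pose s' := Num.min b (sup S + r / 2).
have cs' : sup S < s' by rewrite lt_min cltb ltrDl divr_gt0.
have Qs' : Q s'.
  apply: (hr s) => //; first by rewrite as_.
    by rewrite (ltW cs') ge_min lexx.
  by rewrite gt_min; apply/orP; right; lra.
have : s' <= sup S.
  apply: sup_upper_bound => //; split => //.
  by rewrite (le_trans ac (ltW cs')) ge_min lexx.
by rewrite leNgt cs'.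
Qed.

Lemma lebesgue_measure_disjoint_itvs (R : realType) (n : nat) (u v : 'I_n -> R)
    (U : set R) : open U ->
  (forall i, u i <= v i) ->
  (forall i, `]u i, v i[ `<=` U) ->
  trivIset setT (fun i => `]u i, v i[%classic) ->
  ((\sum_i (v i - u i))%:E <= (@lebesgue_measure R) U)%E.
Proof.
move=> oU uv sub triv.
have -> : ((\sum_i (v i - u i))%:E =
    \sum_i (@lebesgue_measure R) `]u i, v i[%classic)%E.
  rewrite -sumEFin; apply: eq_bigr => i _.
  rewrite lebesgue_measure_itv /= lte_fin.
  case: ltP => // vu; congr (_%:E).
  by apply/eqP; rewrite subr_eq0 eq_le vu uv.
have := @measure_bigsetU_ord_cond _ _ _ (@lebesgue_measure R) n predT
  (fun i => `]u i, v i[%classic).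
move=> /(_ (fun i _ => measurable_itv _)) <-; last by apply: sub_trivIset triv.
apply: le_measure; rewrite ?inE.
- by apply: bigsetU_measurable => i _; exact: measurable_itv.
- exact: open_measurable.
- by elim/big_ind : _ => // X Y XU YU; rewrite subUset.
Qed.

(** Outer regularity makes the open set minus the null set small, and removing a null set does not
    change the measure. *)
Lemma negligible_open_cover (R : realType) (N : set R) (e : R) : 0 < e ->
  (@lebesgue_measure R).-negligible N ->
  exists U : set R, [/\ open U, N `<=` U & ((@lebesgue_measure R) U < e%:E)%E].
Proof.
move=> e0 [N' [mN' N'0 NN']].
pose mu : {measure set (measurableTypeR R) -> \bar R} := @lebesgue_measure R.
have {}N'0 : mu N' = 0%E := N'0.
have muN'y : (mu N' < +oo)%E by rewrite N'0.
have [U [oU NU Ue]] := @lebesgue_regularity_outer R N' e mN' muN'y e0.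
exists U; split => //; first exact: subset_trans NU.
apply: le_lt_trans Ue.
have mU : measurable U by exact: open_measurable.
have UN : U `&` N' = N' by apply/setIidPr.
have UN0 : mu (U `&` N') = 0%E by rewrite UN.
have muU : mu U = (mu (U `\` N') + 0)%E.
  exact: etrans (measureDI mu mU mN') (congr1 (adde _) UN0).
rewrite adde0 in muU.
by rewrite le_eqVlt; apply/orP; left; apply/eqP.
Qed.

(* Real induction over [a, b]: near a good time the increment of f is bounded by
   that of phi; near an exceptional time the interval is recorded in a finite
   disjoint family inside an open set of small measure, where absolute continuity
   makes the total increment small. *)
Lemma absolutely_continuous_growth (R : realType) (d : nat) (a b : R)
    (f : R -> 'cV[R]_d) (phi psi : R -> R) : a <= b ->
  absolutely_continuous_on a b f ->
  {homo phi : s t / s <= t} ->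
  (forall t, is_derive t (1 : R) phi (psi t)) ->
  {ae (@lebesgue_measure R), forall t, a < t < b ->
    exists2 l, is_derive (t : R) (1 : R) f l & `|l| <= psi t} ->
  `|f b - f a| <= phi b - phi a.
Proof.
move=> ab acf phi_mono dphi aef.
apply/ler_addgt0Pr => e' e'0.
(* The errors at good times account for [e * (b - a)], the recorded intervals for the other [e]. *)
have [e e0 ee'] : exists2 e, 0 < e & e * (b - a) + e = e'.
  exists (e' / (b - a + 1)); first by apply: divr_gt0 => //; lra.
  by field; apply: lt0r_neq0; lra.
have [delta d0 Hac] := acf _ e0.
pose N := [set t | a <= t <= b /\
  ~ exists2 l, is_derive (t : R) (1 : R) f l & `|l| <= psi t].
have Nneg : (@lebesgue_measure R).-negligible N.
  have sub : N `<=` [set a] `|` [set b] `|`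
      ~` [set t | a < t < b -> exists2 l, is_derive (t : R) (1 : R) f l
                                        & `|l| <= psi t].
    move=> t [/andP[at_ tb] tN].
    have [->|tna] := eqVneq t a; first by left; left.
    have [->|tnb] := eqVneq t b; first by left; right.
    right => /= H; apply: tN; apply: H.
    by rewrite lt_neqAle eq_sym tna at_ lt_neqAle tnb tb.
  apply: negligibleS; first exact: sub.
  by apply: negligibleU => //; apply: negligibleU;
    (apply/negligibleP; [by []|exact: lebesgue_measure_set1]).
have [U [oU NU Ud]] := negligible_open_cover d0 Nneg.
(* Disjointness is kept as an ordering of endpoints, which is easy to extend when an interval is
   added on the right. *)
pose Q s := exists n (u v : 'I_n -> R),
  [/\ forall i, [/\ a <= u i, u i <= v i & v i <= s],
      forall i, `]u i, v i[ `<=` U,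
      forall i j, i != j -> v i <= u j \/ v j <= u i &
      `|f s - f a| <= phi s - phi a + e * (s - a) + \sum_i `|f (v i) - f (u i)|].
have : Q b.
  apply: (@real_induction _ a b Q ab).
    exists 0%N, (fun=> 0), (fun=> 0); split; [by case|by case|by case|].
    by rewrite big_ord0 !subrr normr0 mulr0 !addr0.
  move=> t atb.
  have [tN|tN] := pselect (N t).
  - have [r /= r0 rU] : exists2 r, 0 < r & ball t r `<=` U.
      by have /nbhs_ballP := open_nbhs_nbhs (conj oU (NU _ tN)).
    exists r => // s s' /andP[as_ st] /andP[ts' s'b] trs s'tr.
    move=> [n [u [v [uv uvU uv_disj H]]]].
    (* The interval from [s] to [s'], inside [U] and to the right of the others, gets index
       [ord0]. *)
    exists n.+1, (fun i => oapp u s (unlift ord0 i)),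
      (fun i => oapp v s' (unlift ord0 i)); split.
    + move=> i; case: unliftP => [j|] _ /=; last by split => //; lra.
      by have [? ? ?] := uv j; split => //; lra.
    + move=> i; case: unliftP => [j|] _ /=; first exact: uvU.
      move=> z /=; rewrite in_itv /= => /andP[sz zs']; apply: rU.
      by rewrite /ball /= ltr_distl; apply/andP; split; lra.
    + move=> i j; case: unliftP => [i'|] ->; case: unliftP => [j'|] -> //=.
      * by rewrite (inj_eq lift_inj); exact: uv_disj.
      * by move=> _; left; have [_ _] := uv i'.
      * by move=> _; right; have [_ _] := uv j'.
    + rewrite big_ord_recl unlift_none /=.
      under eq_bigr do rewrite liftK /=.
      have -> : f s' - f a = (f s' - f s) + (f s - f a) by rewrite subrKA.
      apply: le_trans (ler_normD _ _) _.
      have : phi s <= phi s' by apply: phi_mono; lra.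
      have : e * (s - a) <= e * (s' - a) by rewrite ler_pM2l//; lra.
      by move: H; set S := \sum_i _; lra.
  - have [l dl lpsi] : exists2 l, is_derive (t : R) (1 : R) f l & `|l| <= psi t.
      by apply: contrapT => H; apply: tN; split.
    (* Half of [e] pays for the expansion of [f] at [t], half for that of [phi]. *)
    have e20 : 0 < e / 2 by rewrite divr_gt0.
    have [r1 r10 hr1] := (is_derive_epsP _ _ _).1 dl _ e20.
    have [r2 r20 hr2] := (is_derive_epsP _ _ _).1 (dphi t) _ e20.
    exists (Num.min r1 r2); first by rewrite lt_min r10.
    move=> s s' /andP[as_ st] /andP[ts' s'b].
    rewrite ltrBlDr -ltrBlDl lt_min => /andP[tsr1 tsr2].
    rewrite -ltrBlDl lt_min => /andP[ts'r1 ts'r2].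
    move=> [n [u [v [uv uvU uv_disj H]]]].
    exists n, u, v; split => //.
      by move=> i; have [? ? ?] := uv i; split => //; lra.
    have st0 : `|s - t| = t - s by rewrite ler0_norm ?opprB//; lra.
    have s't0 : `|s' - t| = s' - t by rewrite ger0_norm//; lra.
    have A1 := hr1 s; have A2 := hr1 s'; have B1 := hr2 s; have B2 := hr2 s'.
    rewrite st0 in A1 B1; rewrite s't0 in A2 B2.
    have {}A1 := A1 tsr1; have {}A2 := A2 ts'r1.
    have {}B1 := B1 tsr2; have {}B2 := B2 ts'r2.
    have Df : `|f s' - f s| <= e / 2 * (s' - s) + (s' - s) * psi t.
      have -> : f s' - f s = (f s' - f t - (s' - t) *: l)
          - (f s - f t - (s - t) *: l) + (s' - s) *: l.
        apply/matrixP => i j; rewrite !mxE; ring.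
      apply: le_trans (ler_normD _ _) _; apply: lerD.
        apply: le_trans (ler_normB _ _) _.
        have -> : e / 2 * (s' - s) = e / 2 * (s' - t) + e / 2 * (t - s) by ring.
        exact: lerD.
      rewrite normrZ ger0_norm; last by lra.
      by apply: ler_wpM2l => //; lra.
    have Dphi : (s' - s) * psi t <= phi s' - phi s + e / 2 * (s' - s).
      move: B1 B2; rewrite !ler_norml => /andP[_ B1] /andP[B2 _].
      move: B1 B2; rewrite /GRing.scale /=.
      have -> : e / 2 * (s' - s) = e / 2 * (s' - t) + e / 2 * (t - s) by ring.
      have -> : (s' - s) * psi t = (s' - t) * psi t - (s - t) * psi t by ring.
      lra.
    have -> : f s' - f a = (f s' - f s) + (f s - f a) by rewrite subrKA.
    apply: le_trans (ler_normD _ _) _.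
    have -> : e * (s' - a) = e * (s - a) + e / 2 * (s' - s) + e / 2 * (s' - s)
      by field.
    by move: H; set S := \sum_i _; lra.
move=> [n [u [v [uv uvU uv_disj H]]]].
have triv : trivIset setT (fun i => `]u i, v i[%classic).
  apply/trivIsetP => i j _ _ ij; apply/seteqP; split => // z [/=].
  rewrite !in_itv /= => /andP[z1 z2] /andP[z3 z4].
  by have [] := uv_disj i j ij; lra.
have Sd : \sum_i (v i - u i) < delta.
  rewrite -lte_fin; apply: le_lt_trans Ud.
  by apply: lebesgue_measure_disjoint_itvs => // i; have [] := uv i.
have := Hac n u v uv triv Sd.
by move: H; set S := \sum_i _; rewrite -ee'; lra.
Qed.

Lemma ae_lebesgueS (R : realType) (P Q : R -> Prop) :
  (forall t, P t -> Q t) ->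
  {ae (@lebesgue_measure R), forall t, P t} ->
  {ae (@lebesgue_measure R), forall t, Q t}.
Proof.
by move=> PQ; apply: filterS => //; exact: (ae_filter_ringOfSetsType lebesgue_measure).
Qed.

Lemma ae_lebesgueI (R : realType) (P Q : R -> Prop) :
  {ae (@lebesgue_measure R), forall t, P t} ->
  {ae (@lebesgue_measure R), forall t, Q t} ->
  {ae (@lebesgue_measure R), forall t, P t /\ Q t}.
Proof.
by move=> hP hQ; apply: filterI => //; exact: (ae_filter_ringOfSetsType lebesgue_measure).
Qed.

(* The factor 1/2 makes the integral operator a contraction for the weight
   exp(2 L t), uniformly in T. *)
Lemma exponential_growth (R : realType) (d : nat) (T L c : R)
    (z : R -> 'cV[R]_d) : 0 <= T -> 0 <= L -> 0 <= c ->
  absolutely_continuous_on 0 T z -> z 0 = 0 ->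
  {ae (@lebesgue_measure R), forall t, 0 < t < T ->
    exists2 l, is_derive (t : R) (1 : R) z l &
      `|l| <= L * (c * expR (L * t *+ 2))} ->
  `|z T| <= c / 2 * expR (L * T *+ 2).
Proof.
move=> T0 L0 c0 acz z0 aez.
pose phi t := c / 2 * expR (L * t *+ 2).
have dphi t : is_derive t (1 : R) phi (L * (c * expR (L * t *+ 2))).
  have d1 : is_derive t (1 : R) (fun t => L * t *+ 2) (L *+ 2).
    have -> : (fun t => L * t *+ 2) = (L *+ 2) *: (id : R -> R^o).
      by apply/funext => s /=; rewrite -mulrnAl.
    by apply: is_derive_eq; rewrite /GRing.scale /= mulr1.
  have d2 := is_derive1_comp (is_derive_expR _) d1.
  have -> : phi = (c / 2) *: (expR \o (fun t => L * t *+ 2) : R -> R^o).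
    by apply/funext => s.
  apply: is_derive_eq; rewrite /GRing.scale /=.
  by rewrite -mulr_natl; field.
have mphi : {homo phi : s t / s <= t}.
  move=> s t st; apply: ler_wpM2l; first by lra.
  by rewrite ler_expR lerMn2r /= ler_wpM2l.
have := absolutely_continuous_growth T0 acz mphi dphi aez.
rewrite z0 subr0 => /le_trans; apply; rewrite /phi.
by rewrite gerBl mulr_ge0 ?expR_ge0//; lra.
Qed.

(** * Properties of absolute continuity *)

Lemma lipschitz_absolutely_continuous (R : realType) (d : nat) (a b K : R)
    (f : R -> 'cV[R]_d) :
  (forall s t, a <= s -> s <= t -> t <= b -> `|f t - f s| <= K * (t - s)) ->
  absolutely_continuous_on a b f.
Proof.
move=> lipf e e0.
have K0 : 0 < `|K| + 1 by rewrite ltr_wpDl.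
exists (e / (`|K| + 1)); first exact: divr_gt0.
move=> n u v uv _ uvd.
apply: le_lt_trans (_ : (`|K| + 1) * \sum_i (v i - u i) < e); last first.
  by rewrite mulrC -ltr_pdivlMr.
rewrite mulr_sumr; apply: ler_sum => i _; have [aui uivi vib] := uv i.
apply: le_trans (lipf _ _ aui uivi vib) _.
by apply: ler_wpM2r; [lra | have := ler_norm K; lra].
Qed.

Lemma absolutely_continuous_lincomb (R : realType) (d n : nat) (a b : R)
    (c : 'I_n -> R) (f : 'I_n -> R -> 'cV[R]_d) :
  (forall k, absolutely_continuous_on a b (f k)) ->
  absolutely_continuous_on a b (fun t => \sum_k c k *: f k t).
Proof.
elim: n c f => [|n IH] c f acf.
  move=> e e0; exists 1 => // m u v _ _ _.
  by rewrite big1// => i _; rewrite !big_ord0 subrr normr0.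
move=> e e0.
have K0 : 0 < `|c ord0| + 1 by rewrite ltr_wpDl.
have [d1 d10 H1] := acf ord0 _ (divr_gt0 e0 (mulr_gt0 (ltr0n _ 2) K0)).
have e20 : 0 < e / 2 by lra.
have [d2 d20 H2] := IH (c \o lift ord0) (f \o lift ord0)
  (fun k => acf _) _ e20.
exists (Num.min d1 d2); first by rewrite lt_min d10.
move=> m u v uv triv; rewrite lt_min => /andP[/(H1 _ _ _ uv triv) {}H1
  /(H2 _ _ _ uv triv) {}H2].
apply: le_lt_trans (_ : `|c ord0| * \sum_i `|f ord0 (v i) - f ord0 (u i)| +
   \sum_i `|\sum_k (c \o lift ord0) k *: (f \o lift ord0) k (v i)
      - \sum_k (c \o lift ord0) k *: (f \o lift ord0) k (u i)| < e).
  rewrite mulr_sumr -big_split; apply: ler_sum => i _ /=.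
  rewrite !big_ord_recl -normrZ scalerBr opprD addrACA.
  exact: ler_normD.
have -> : e = e / 2 + e / 2 by field.
apply: ler_ltD H2.
apply: le_trans (_ : (`|c ord0| + 1) * (e / (2 * (`|c ord0| + 1))) <= _).
  apply: ler_pM => //; [exact: sumr_ge0|by lra|exact: ltW].
by rewrite le_eqVlt; apply/orP; left; apply/eqP; field; exact: lt0r_neq0.
Qed.

Lemma absolutely_continuous_sub (R : realType) (d : nat) (a b : R)
    (f g : R -> 'cV[R]_d) :
  absolutely_continuous_on a b f -> absolutely_continuous_on a b g ->
  absolutely_continuous_on a b (f \- g).
Proof.
move=> acf acg.
have := @absolutely_continuous_lincomb R d 2 a b
  (fun i => if i == ord0 then 1 else -1) (fun i => if i == ord0 then f else g).
move=> /(_ _)/wrap[]; first by move=> k; case: ifP.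
move=> H e /H[delta d0 {}H]; exists delta => // n u v uv triv uvd.
have := H n u v uv triv uvd; congr (_ < _); apply: eq_bigr => i _.
by rewrite !big_ord_recl !big_ord0 /= !scale1r !scaleN1r !addr0.
Qed.

Lemma absolutely_continuous_shift (R : realType) (d : nat) (a b T : R)
    (f : R -> 'cV[R]_d) :
  absolutely_continuous_on (a + T) (b + T) f ->
  absolutely_continuous_on a b (fun t => f (t + T)).
Proof.
move=> acf e /acf[delta d0 H]; exists delta => // n u v uv triv uvd.
apply: (H n (fun i => u i + T) (fun i => v i + T)).
- by move=> i; have [? ? ?] := uv i; rewrite !lerD2r.
- apply/trivIsetP => i j _ _ ij; apply/seteqP; split => // z [/=].
  rewrite !in_itv /= => /andP[z1 z2] /andP[z3 z4].
  have /trivIsetP/(_ i j I I ij) := triv.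
  by move/seteqP => [/(_ (z - T)) + _]; apply; split; rewrite /= in_itv /=;
    apply/andP; split; lra.
- by under eq_bigr do rewrite opprD addrACA subrr addr0.
Qed.

Lemma absolutely_continuous_uniform (R : realType) (d : nat) (a b : R)
    (f : R -> 'cV[R]_d) : absolutely_continuous_on a b f ->
  forall e, 0 < e -> exists2 delta, 0 < delta &
    forall s t, a <= s -> s <= t -> t <= b -> t - s < delta -> `|f t - f s| < e.
Proof.
move=> acf e /acf[delta d0 H]; exists delta => // s t as_ st tb std.
have := H 1%N (fun=> s) (fun=> t); rewrite !big_ord1; apply => //.
by apply/trivIsetP => i j; rewrite (ord1 i) (ord1 j).
Qed.

(** Real induction with windows shorter than [delta]: crossing one raises the bound by at most 1. *)
Lemma absolutely_continuous_bounded (R : realType) (d : nat) (a b : R)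
    (f : R -> 'cV[R]_d) : a <= b -> absolutely_continuous_on a b f ->
  exists2 K, 0 <= K & forall t, a <= t <= b -> `|f t| <= K.
Proof.
move=> ab /absolutely_continuous_uniform/(_ _ ltr01)[delta d0 H].
apply: (@real_induction _ a b
  (fun s => exists2 K, 0 <= K & forall t, a <= t <= s -> `|f t| <= K) ab).
  exists `|f a| => // t; rewrite -eq_le => /eqP <-; exact: lexx.
move=> t atb; exists (delta / 2); first by rewrite divr_gt0.
move=> s s' /andP[as_ st] /andP[ts' s'b] tds s'td [K K0 HK].
exists (K + 1); first by lra.
move=> u /andP[au us'].
have [us|su] := leP u s.
  by apply: le_trans (HK u _) _; [rewrite au us|lra].
have Hsu := H s u as_ (ltW su) (le_trans us' s'b) ltac:(lra).
have Hs : `|f s| <= K by apply: HK; rewrite as_ lexx.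
have := ler_normD (f s) (f u - f s).
by rewrite [f s + _]addrC subrK; lra.
Qed.

(** * Linear Caratheodory equations *)

Lemma ae_lebesgue_neq (R : realType) (a : R) :
  {ae (@lebesgue_measure R), forall t : R, t != a}.
Proof.
have sub : ~` [set t : R | t != a] `<=` [set a].
  by move=> t /= /negP/negPn/eqP.
apply: negligibleS; first exact: sub.
by apply/negligibleP; [by []|exact: lebesgue_measure_set1].
Qed.

(** The primitive is the Lebesgue integral from 0, differentiable almost everywhere by the
    fundamental theorem of calculus. The Lipschitz bound later yields absolute continuity. *)
Lemma scalar_antiderivative (R : realType) (g : R -> R) :
  measurable_fun (`[0, +oo[ : set (measurableTypeR R)) g ->
  (forall T : R, exists K : R, forall t : R, 0 <= t <= T -> `|g t| <= K) ->
  exists F : R -> R, [/\ F 0 = 0,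
    forall T K : R, (forall t : R, 0 <= t <= T -> `|g t| <= K) ->
      forall s t : R, 0 <= s -> s <= t -> t <= T -> `|F t - F s| <= K * (t - s) &
    {ae (@lebesgue_measure R), forall t, 0 <= t ->
      is_derive (t : R) (1 : R) F (g t)}].
Proof.
move=> mg bg; pose mu := @lebesgue_measure R.
(* Extension by zero to negative times gives a locally integrable function on the whole line. *)
pose g0 := g \_ `[0, +oo[.
have g0E t : 0 <= t -> g0 t = g t.
  by move=> t0; rewrite /g0 patchE mem_set//= in_itv /= t0.
have g0N t : t < 0 -> g0 t = 0.
  move=> t0; rewrite /g0 patchE memNset//= in_itv /= andbT.
  by apply/negP; rewrite -ltNge.
have mg0 : measurable_fun (setT : set (measurableTypeR R)) g0.
  by apply/(measurable_restrictT _ _).1 => //; exact: measurable_itv.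
have bg0 T : exists2 K, 0 <= K & forall t, t <= T -> `|g0 t| <= K.
  have [K HK] := bg T; exists `|K| => // t tT.
  have [t0|t0] := leP 0 t; last by rewrite g0N// normr0.
  by rewrite g0E//; apply: le_trans (HK t _) (ler_norm _); rewrite t0.
have int0 (A : set (measurableTypeR R)) : measurable A -> (mu A < +oo)%E ->
    (exists T, forall t, A t -> t <= T) -> mu.-integrable A (EFin \o g0).
  move=> mA muA [T AT]; apply: measurable_bounded_integrable => //.
    exact: measurable_funS mg0.
  have [K K0 HK] := bg0 T; exists K; split; first exact: num_real.
  by move=> M KM t At /=; apply: le_trans (HK t (AT _ At)) (ltW KM).
have int0y (y : R) : mu.-integrable `[0, y] (EFin \o g0).
  apply: int0; first exact: measurable_itv.
    by rewrite /mu lebesgue_measure_itv /=; case: ifP => // _; rewrite ltry.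
  by exists y => t /=; rewrite in_itv /= => /andP[].
have loc0 : locally_integrable setT g0.
  split => //; first exact: openT.
  move=> K _ cK.
  have /integrableP[_] : mu.-integrable K (EFin \o g0).
    apply: int0; [exact: compact_measurable|exact: compact_finite_measure|].
    have [M [_ MK]] := compact_bounded cK; exists (M + 1) => t Kt.
    by apply: le_trans (ler_norm _) (MK _ _ _ Kt); rewrite ltrDl.
  by [].
pose F y := (\int[mu]_(t in `[0%R, y]) g0 t)%R.
exists F; split.
- rewrite /F set_itv1; exact: Rintegral_set1.
- move=> T K HK s t s0 st tT.
  have -> : F t - F s = (\int[mu]_(x in `]s, t]) g0 x)%R.
    apply: Rintegral_itvB => //; by rewrite bnd_simp.
  have ist : mu.-integrable `]s, t] (EFin \o g0).
    apply: integrableS (int0y t); [exact: measurable_itv..|].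
    by move=> x /=; rewrite !in_itv /= => /andP[/ltW sx ->]; rewrite (le_trans s0 sx).
  apply: le_trans (le_normr_Rintegral _ ist) _; first exact: measurable_itv.
  have mst : mu `]s, t]%classic = (t - s)%:E.
    rewrite /mu lebesgue_measure_itv /= lte_fin; case: ltP => //.
    by move=> ts; congr (_%:E); apply/eqP; rewrite eq_sym subr_eq0 eq_le st ts.
  have -> : K * (t - s) = (\int[mu]_(x in `]s, t]) K)%R.
    apply: esym; apply: etrans (congr1 (fun z => K * fine z) mst).
    by apply: Rintegral_cst; exact: measurable_itv.
  apply: le_Rintegral; first exact: measurable_itv.
  + exact: integrable_norm ist.
  + apply: measurable_bounded_integrable => //.
      by apply: le_lt_trans (ltry (t - s)); rewrite le_eqVlt; apply/orP; left;
        apply/eqP; exact: mst.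
    exists `|K|; split; first exact: num_real.
    by move=> M KM x _ /=; exact: ltW.
  + move=> x /=; rewrite in_itv /= => /andP[sx xt].
    have x0 : 0 <= x by exact: le_trans (ltW sx).
    by rewrite g0E// HK// x0 (le_trans xt tT).
(* The derivative is obtained for [t > 0] only; the base point 0 is a null set. *)
- have := @FTC1 R g0 (BLeft 0) int0y loc0.
  move=> /(ae_lebesgueI (ae_lebesgue_neq 0)).
  apply: ae_lebesgueS => t [tN0 H] t0.
  have [|dF dFE] := H; first by rewrite lte_fin lt_neqAle eq_sym tN0.
  by split => //; rewrite -derive1E dFE g0E.
Qed.

Lemma absolutely_continuous_measurable (R : realType) (d : nat)
    (f : R -> 'cV[R]_d) (i : 'I_d) :
  (forall T, 0 <= T -> absolutely_continuous_on 0 T f) ->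
  measurable_fun (`[0, +oo[ : set (measurableTypeR R)) (fun t => f t i 0).
Proof.
move=> acf.
(* Freezing [f] at [f 0] for negative times gives a function continuous on the whole line, hence
   Borel measurable. *)
pose G (t : R) := f (Num.max 0 t) i 0.
have cG : continuous G.
  move=> t; apply/cvgrPdist_lt => e e0.
  have T0 : 0 <= `|t| + 1 by rewrite addr_ge0.
  have [delta d0 H] := absolutely_continuous_uniform (acf _ T0) e0.
  near=> s.
  have H' u v : u <= v -> v <= `|t| + 1 -> v - u < delta ->
      `|f (Num.max 0 v) - f (Num.max 0 u)| < e.
    move=> uv vt uvd; apply: H.
    - by rewrite le_max lexx.
    - by rewrite ge_max !le_max lexx uv orbT.
    - by rewrite ge_max T0 vt.
    - rewrite /Num.max; case: (ltP 0 v); case: (ltP 0 u); lra.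
  have tT : t <= `|t| + 1 by have := ler_norm t; lra.
  have sT : s <= `|t| + 1.
    suff : `|t - s| < 1 by rewrite ltr_norml; have := ler_norm t; lra.
    by near: s; apply: (@nbhsx_ballx _ R).
  have std : `|t - s| < delta by near: s; apply: (@nbhsx_ballx _ R).
  have entry (u v : 'cV[R]_d) : `|u i 0 - v i 0| <= `|u - v|.
    have := @le_bigmax _ _ _ 0 (fun ij => `|(u - v) ij.1 ij.2|) (i, 0).
    by rewrite /= !mxE [X in _ -> _ <= X]/Num.Def.normr /= mx_normrE.
  apply: le_lt_trans (entry _ _) _.
  have [st|ts] := leP s t.
    by apply: H' => //; apply: le_lt_trans std; exact: ler_norm.
  rewrite distrC; apply: H' => //; first exact: ltW.
  by apply: le_lt_trans std; rewrite distrC ler_norm.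
have : measurable_fun (`[0, +oo[ : set (measurableTypeR R)) G.
  exact: measurable_funTS (continuous_measurable_fun cG).
apply: eq_measurable_fun => t; rewrite inE /= in_itv /= andbT => t0.
by rewrite /G max_r.
Unshelve. all: by end_near. Qed.

Lemma cV_norm_le (R : realType) (d : nat) (u : 'cV[R]_d) (K : R) :
  0 <= K -> (forall i, `|u i 0| <= K) -> `|u| <= K.
Proof.
move=> K0 H; rewrite /Num.Def.normr /= mx_normrE; apply: bigmax_le => // -[i j] _ /=.
by rewrite (ord1 j).
Qed.

Lemma mx_norm_entry (R : realType) (m n : nat) (u : 'M[R]_(m, n)) i j :
  `|u i j| <= `|u|.
Proof.
rewrite [leRHS]/Num.Def.normr /= mx_normrE.
exact: (@le_bigmax _ _ _ 0 (fun ij => `|u ij.1 ij.2|) (i, j)).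
Qed.

Lemma mulmx_norm_le (R : realType) (d : nat) (A : 'M[R]_d) (w : 'cV[R]_d) :
  `|A *m w| <= d%:R * `|A| * `|w|.
Proof.
apply: cV_norm_le => [|i]; first by rewrite !mulr_ge0.
rewrite mxE; apply: le_trans (ler_norm_sum _ _ _) _.
apply: le_trans (_ : \sum_(k < d) `|A| * `|w| <= _).
  by apply: ler_sum => k _; rewrite normrM ler_pM// mx_norm_entry.
by rewrite sumr_const card_ord -mulrA mulr_natl.
Qed.

Lemma antiderivative_exists (R : realType) (d : nat) (g : R -> 'cV[R]_d)
    (v : 'cV[R]_d) :
  (forall i, measurable_fun (`[0, +oo[ : set (measurableTypeR R))
    (fun t => g t i 0)) ->
  (forall T : R, exists K : R, forall t : R, 0 <= t <= T -> `|g t| <= K) ->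
  exists y : R -> 'cV[R]_d, [/\ y 0 = v,
    forall T, 0 <= T -> absolutely_continuous_on 0 T y &
    {ae (@lebesgue_measure R), forall t, 0 <= t ->
      is_derive (t : R) (1 : R) y (g t)}].
Proof.
move=> mg bg.
have bgi i T : exists K, forall t : R, 0 <= t <= T -> `|g t i 0| <= K.
  have [K HK] := bg T; exists K => t /HK; apply: le_trans.
  exact: mx_norm_entry.
have [F HF] := choice (fun i => scalar_antiderivative (mg i) (bgi i)).
exists (fun t => v + \col_i F i t); split.
- apply/matrixP => i j; rewrite !mxE; have [-> _ _] := HF i.
  by rewrite addr0 (ord1 j).
- move=> T T0; have [K HK] := bg T.
  apply: (@lipschitz_absolutely_continuous _ _ _ _ `|K|) => s t s0 st tT.
  apply: cV_norm_le => [|i]; first by rewrite mulr_ge0// subr_ge0.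
  rewrite !mxE opprD addrACA subrr add0r.
  have [_ H _] := HF i; apply: H s0 st tT => u /HK.
  move=> /(le_trans (mx_norm_entry _ i 0)) /le_trans; apply; exact: ler_norm.
(* There are finitely many coordinates, so the exceptional null sets have a null union. *)
- have aeF : {ae (@lebesgue_measure R), forall t : R, forall i, 0 <= t ->
      is_derive (t : R) (1 : R) (F i) (g t i 0)}.
    apply: (@filter_forall _ _ _ _ (ae_filter_ringOfSetsType lebesgue_measure)).
    by move=> i; have [_ _] := HF i.
  apply: ae_lebesgueS aeF => t H t0.
  have dcoord i j : is_derive t (1 : R) (fun s => (v + \col_k F k s) i j) (g t i 0).
    have -> : (fun s => (v + \col_k F k s) i j) = (cst (v i j) : R -> R^o) + (F i : R -> R^o).
      by apply/funext => s; rewrite !mxE.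
    have dF := H i t0.
    by apply: is_derive_eq; rewrite add0r.
  have dv : derivable (fun s => v + \col_k F k s) t 1.
    by apply/derivable_mxP => i j; have [] := dcoord i j.
  split => //; rewrite (derive_mx dv); apply/matrixP => i j; rewrite mxE.
  by have [_ ->] := dcoord i j; rewrite (ord1 j).
Qed.


(** * Picard iteration for a bounded law *)

Lemma halves_le0 (R : realType) (r b : R) :
  (forall n, r <= b / 2 ^+ n) -> r <= 0.
Proof.
move=> H; rewrite leNgt; apply/negP => r0.
have b0 : 0 < b by have := H 0%N; rewrite expr0 divr1; exact: lt_le_trans.
have br0 : 0 <= b / r by rewrite divr_ge0// ltW.
have := archi_boundP br0; set n := Num.bound _ => bn.
have n2 : n%:R <= 2 ^+ n :> R by rewrite -natrX ler_nat ltnW// ltn_expl.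
have := H n; rewrite ler_pdivlMr ?exprn_gt0// leNgt => /negP; apply.
by rewrite mulrC -ltr_pdivrMr//; exact: lt_le_trans n2.
Qed.

(** The intervals of radius [2 * b / 2 ^+ n] about [u n] are nested, and the supremum of their left
    ends lies in all of them. The limit thus comes with an explicit rate. *)
Lemma geometric_cauchy (R : realType) (u : nat -> R) (b : R) : 0 <= b ->
  (forall n, `|u n.+1 - u n| <= b / 2 ^+ n) ->
  exists l, forall n, `|l - u n| <= 2 * b / 2 ^+ n.
Proof.
move=> b0 H.
pose v n := u n - 2 * b / 2 ^+ n; pose w n := u n + 2 * b / 2 ^+ n.
have e n : 2 * b / 2 ^+ n.+1 = b / 2 ^+ n.
  by rewrite exprS; field; rewrite expf_neq0.
have e' n : 2 * b / 2 ^+ n = b / 2 ^+ n + b / 2 ^+ n by rewrite -mulrA; ring.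
have vS n : v n <= v n.+1.
  by rewrite /v e e'; have := H n; rewrite ler_norml => /andP[]; lra.
have wS n : w n.+1 <= w n.
  by rewrite /w e e'; have := H n; rewrite ler_norml => /andP[]; lra.
have vle : {homo v : m n / (m <= n)%N >-> m <= n}.
  by apply: homo_leq => //; exact: le_trans.
have wge : {homo w : m n / (m <= n)%N >-> n <= m}.
  by apply: homo_leq => // x y z yx zy; exact: le_trans zy yx.
have vw n m : v n <= w m.
  apply: le_trans (vle _ _ (leq_maxl n m)) _.
  apply: le_trans (wge _ _ (leq_maxr n m)).
  have : 0 <= b / 2 ^+ maxn n m by rewrite divr_ge0// exprn_ge0.
  by rewrite /v /w e'; lra.
have supv : has_sup (range v).
  by split; [exists (v 0%N); exists 0%N|exists (w 0%N) => _ [n _ <-]].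
exists (sup (range v)) => n.
have h1 : v n <= sup (range v) by apply: sup_upper_bound => //; exists n.
have h2 : sup (range v) <= w n.
  by apply: ge_sup => [|_ [m _ <-]//]; exists (v 0%N); exists 0%N.
by rewrite ler_norml; move: h1 h2; rewrite /v /w => h1 h2; apply/andP; split; lra.
Qed.

(** The law is exposed, so that uniqueness and linearity can be stated for it. *)
Definition solution (R : realType) (d : nat) (A : R -> 'M[R]_d)
    (x : R -> 'cV[R]_d) : Prop :=
  (forall T : R, 0 <= T -> absolutely_continuous_on 0 T x) /\
  {ae (@lebesgue_measure R), forall t, 0 <= t ->
    is_derive (t : R) (1 : R) x (A t *m x t)}.

Definition bounded_law (R : realType) (d : nat) (L : R) (A : R -> 'M[R]_d) :=
  (forall i j, measurable_fun (`[0, +oo[ : set (measurableTypeR R))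
     (fun t => A t i j)) /\
  forall (t : R) (w : 'cV[R]_d), 0 <= t -> `|A t *m w| <= L * `|w|.

Lemma mx_entry_measurable (R : realType) (m n : nat) (i : 'I_m) (j : 'I_n) :
  measurable_fun
    (setT : set (g_sigma_algebraType (@open 'M[R]_(m, n))))
    (fun M => M i j).
Proof.
apply: (measurability _ (RGenOInfty.measurableE R)) => _ [_ [x ->] <-].
rewrite setTI; apply: sub_sigma_algebra.
have : continuous (fun M : 'M[R]_(m, n) => M i j) by exact: coord_continuous.
by move/continuousP; apply; exact: interval_open.
Qed.

(** All laws take values in one compact set, so a single [L] also serves their concatenations. *)
Lemma switching_law_bounded (R : realType) (d : nat) (cA : set 'M[R]_d) :
  compact cA ->
  exists2 L, 0 <= L & forall A, switching_law cA A -> bounded_law L A.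
Proof.
move=> /compact_bounded[K [_ HK]].
have {}HK M : cA M -> `|M| <= `|K| + 1.
  by move=> /HK; apply; have := ler_norm K; lra.
exists (d%:R * (`|K| + 1)); first by rewrite mulr_ge0// addr_ge0.
move=> A [mA Aval]; split=> [i j|t w t0].
  exact: (measurableT_comp (mx_entry_measurable i j) mA).
apply: le_trans (mulmx_norm_le _ _) _; apply: ler_wpM2r => //.
by apply: ler_wpM2l => //; exact: HK (Aval _ t0).
Qed.

Section solutions.
Context (R : realType) (d : nat) (L : R) (L0 : 0 <= L).
Implicit Types (A : R -> 'M[R]_d) (x y z : R -> 'cV[R]_d) (v : 'cV[R]_d).

(** Enough, under a bounded law, for [A t *m x t] to have an antiderivative, and easily passed to
    the limit of the Picard iterates. *)
Let regular x :=
  (forall i, measurable_fun (`[0, +oo[ : set (measurableTypeR R))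
     (fun t => x t i 0)) /\
  forall T : R, exists K : R, forall t : R, 0 <= t <= T -> `|x t| <= K.

Let ac_regular x :
  (forall T, 0 <= T -> absolutely_continuous_on 0 T x) -> regular x.
Proof.
move=> acx; split=> [i|T]; first exact: absolutely_continuous_measurable.
have [T0|T0] := leP 0 T.
  by have [K _ HK] := absolutely_continuous_bounded T0 (acx T T0); exists K.
by exists 0 => t /andP[t0 tT]; move: (le_trans t0 tT); rewrite leNgt T0.
Qed.

Let picard_step A v x : bounded_law L A -> regular x ->
  exists y, [/\ y 0 = v,
    forall T, 0 <= T -> absolutely_continuous_on 0 T y &
    {ae (@lebesgue_measure R), forall t, 0 <= t ->
      is_derive (t : R) (1 : R) y (A t *m x t)}].
Proof.
move=> [mA bA] [mx bx]; apply: antiderivative_exists => [i|T].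
  have -> : (fun t => (A t *m x t) i 0) = (fun t => \sum_k A t i k * x t k 0).
    by apply/funext => t; rewrite mxE.
  by apply: measurable_sum => k; exact: measurable_funM.
have [K HK] := bx T; exists (L * K) => t tT; have /andP[t0 _] := tT.
by apply: le_trans (bA _ _ t0) _; apply: ler_wpM2l => //; exact: HK.
Qed.

(** Typically [x] is a difference of two functions and [z] that of their Picard images: each step
    halves the weighted bound. *)
Let growth A c T z x : bounded_law L A -> 0 <= c -> 0 <= T ->
  absolutely_continuous_on 0 T z -> z 0 = 0 ->
  (forall t, 0 <= t <= T -> `|x t| <= c * expR (L * t *+ 2)) ->
  {ae (@lebesgue_measure R), forall t : R, 0 < t < T ->
    is_derive (t : R) (1 : R) z (A t *m x t)} ->
  `|z T| <= c / 2 * expR (L * T *+ 2).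
Proof.
move=> [_ bA] c0 T0 acz z0 xle dz.
apply: exponential_growth => //; apply: ae_lebesgueS dz => t dz tT.
have /andP[/ltW t0 /ltW tT'] := tT.
exists (A t *m x t); first exact: dz.
apply: le_trans (bA _ _ t0) _; apply: ler_wpM2l => //.
by apply: xle; rewrite t0.
Qed.

Let derive_sub A x x' y y' T :
  {ae (@lebesgue_measure R), forall t, 0 <= t ->
      is_derive (t : R) (1 : R) y (A t *m x t)} ->
  {ae (@lebesgue_measure R), forall t, 0 <= t ->
      is_derive (t : R) (1 : R) y' (A t *m x' t)} ->
  {ae (@lebesgue_measure R), forall t, 0 < t < T ->
      is_derive (t : R) (1 : R) (y \- y') (A t *m (x \- x') t)}.
Proof.
move=> dy dy'; have := ae_lebesgueI dy dy'.
apply: ae_lebesgueS => t [{}dy {}dy'] /andP[/ltW t0 _].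
rewrite mulmxBr; apply: is_deriveB; [exact: dy|exact: dy'].
Qed.

(** The Picard iterates from the constant [v] converge geometrically in the weight. Their limit [x]
    is first known only to be measurable and locally bounded; its Picard image [P x] is absolutely
    continuous and coincides with [x] for nonnegative times, hence is a solution. *)
Lemma solution_exists A v : bounded_law L A ->
  exists2 x, x 0 = v & solution A x.
Proof.
move=> bA.
(* Placing regularity under the existential makes the Picard operator total, as [choice]
   requires. *)
have stepX x : exists y, regular x -> [/\ y 0 = v,
    forall T, 0 <= T -> absolutely_continuous_on 0 T y &
    {ae (@lebesgue_measure R), forall t, 0 <= t ->
      is_derive (t : R) (1 : R) y (A t *m x t)}].
  have [rx|rx] := pselect (regular x); last by exists x.
  by have [y] := picard_step v bA rx; exists y.
have [P HP] := choice stepX.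
pose X n := iter n P (fun=> v).
have acX n : (forall T, 0 <= T -> absolutely_continuous_on 0 T (X n)) /\ X n 0 = v.
  elim: n => [|n [IH _]].
    split => // T T0; apply: (@lipschitz_absolutely_continuous _ _ _ _ 0).
    by move=> s t _ _ _; rewrite subrr normr0 mul0r.
  by have [? ? ?] := HP _ (ac_regular IH).
have dX n : {ae (@lebesgue_measure R), forall t, 0 <= t ->
      is_derive (t : R) (1 : R) (X n.+1) (A t *m X n t)}.
  by have [_ _] := HP _ (ac_regular (acX n).1).
have e1 t : 0 <= t -> 1 <= expR (L * t *+ 2).
  by move=> t0; rewrite -[leLHS]expR0 ler_expR mulrn_wge0// mulr_ge0.
have diff n t : 0 <= t ->
    `|X n.+1 t - X n t| <= `|v| / 2 ^+ n * expR (L * t *+ 2).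
  elim: n t => [|n IH] T T0.
    have H : `|X 1%N T - X 0%N T| <= `|v| / 2 * expR (L * T *+ 2).
      apply: (@growth A _ _ (X 1%N \- X 0%N) (fun=> v)) => //.
      - by apply: absolutely_continuous_sub; apply: (acX _).1.
      - by apply/eqP; rewrite subr_eq0; apply/eqP/(etrans (acX _).2)/esym/(acX _).2.
      - by move=> t /andP[t0 _]; rewrite ler_peMr// e1.
      - apply: ae_lebesgueS (dX 0%N) => t dz /andP[/ltW t0 _].
        have {}dz := dz t0.
        have -> : X 1%N \- X 0%N = (X 1%N \- cst v) by [].
        by rewrite -[A t *m _]subr0; apply: is_deriveB.
    apply: le_trans H _; rewrite expr0 divr1 ler_wpM2r ?expR_ge0//.
    by have := normr_ge0 v; lra.
  have -> : `|v| / 2 ^+ n.+1 = `|v| / 2 ^+ n / 2.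
    by rewrite exprS; field; rewrite expf_neq0.
  apply: (@growth A _ _ (X n.+2 \- X n.+1) (X n.+1 \- X n)) => //.
  - by apply: absolutely_continuous_sub; apply: (acX _).1.
  - by apply/eqP; rewrite subr_eq0; apply/eqP/(etrans (acX _).2)/esym/(acX _).2.
  - by move=> t /andP[t0 _]; exact: IH.
  - by apply: derive_sub; exact: dX.
have lim t : 0 <= t -> exists l : 'cV[R]_d, forall n,
    `|l - X n t| <= 2 * (`|v| * expR (L * t *+ 2)) / 2 ^+ n.
  move=> t0; have b0 : 0 <= `|v| * expR (L * t *+ 2) by rewrite mulr_ge0// expR_ge0.
  have /choice[l Hl] : forall i : 'I_d, exists l, forall n,
      `|l - X n t i 0| <= 2 * (`|v| * expR (L * t *+ 2)) / 2 ^+ n.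
    move=> i; apply: geometric_cauchy => // n.
    rewrite mulrAC; apply: le_trans (diff n t t0).
    by have := mx_norm_entry (X n.+1 t - X n t) i 0; rewrite !mxE.
  exists (\col_i l i) => n; apply: cV_norm_le => [|i]; last by rewrite !mxE.
  by rewrite divr_ge0 ?exprn_ge0// mulr_ge0.
have limX t : exists l : 'cV[R]_d, 0 <= t -> forall n,
    `|l - X n t| <= 2 * (`|v| * expR (L * t *+ 2)) / 2 ^+ n.
  have [t0|t0] := leP 0 t; last by exists 0.
  by have [l Hl] := lim t t0; exists l.
have [x Hx] := choice limX.
have rx : regular x.
  split=> [i|T].
  - apply: (@measurable_fun_cvg _ _ _ _ (fun n t => X n t i 0)).
      by move=> n; exact: (ac_regular (acX n).1).1.
    move=> t; rewrite /= in_itv /= andbT => t0.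
    set b := 2 * (`|v| * expR (L * t *+ 2)).
    apply/cvgrPdist_le => e e0; near=> n.
    have := mx_norm_entry (x t - X n t) i 0; rewrite !mxE => /le_trans; apply.
    apply: le_trans (Hx t t0 n) _; rewrite -/b.
    have -> : b / 2 ^+ n = geometric b 2^-1 n by rewrite /geometric /= exprVn.
    apply: le_trans (ler_norm _) _.
    near: n.
    have : geometric b (2^-1 : R) @ \oo --> (0 : R).
      by apply: cvg_geometric; rewrite ger0_norm ?invr_ge0// invf_lt1// ltr1n.
    by move/cvgr0Pnorm_le; apply.
  - exists (`|v| + 2 * (`|v| * expR (L * T *+ 2))) => t /andP[t0 tT].
    have := Hx t t0 0%N; rewrite expr0 divr1.
    have := ler_normD (x t - v) v; rewrite subrK /X /=.
    have : 2 * (`|v| * expR (L * t *+ 2)) <= 2 * (`|v| * expR (L * T *+ 2)).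
      rewrite ler_wpM2l// ler_wpM2l// ler_expR lerMn2r /=.
      by rewrite ler_wpM2l.
    lra.
have [y0 acy dy] := HP _ rx.
(* [P x] and [X n.+1] are the Picard images of [x] and [X n], so their distance is at most half the
   bound on the distance of [x] to [X n]; both tend to 0. *)
have yx t : 0 <= t -> P x t = x t.
  move=> t0; apply/eqP; rewrite -subr_eq0 -normr_le0.
  pose b := `|v| * expR (L * t *+ 2).
  apply: (@halves_le0 _ _ (2 * b)) => n.
  have h1 := Hx t t0 n.+1.
  have h2 : `|P x t - X n.+1 t| <= 2 * `|v| / 2 ^+ n / 2 * expR (L * t *+ 2).
    apply: (@growth A _ _ (P x \- X n.+1) (x \- X n)) => //.
    - by apply: absolutely_continuous_sub; [exact: acy|apply: (acX _).1].
    - by apply/eqP; rewrite subr_eq0; apply/eqP/(etrans y0)/esym/(acX _).2.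
    - move=> s /andP[s0 _]; apply: le_trans (Hx s s0 n) _.
      by rewrite mulrA mulrAC.
    - by apply: derive_sub => //; exact: dX.
  apply: le_trans (ler_distD (X n.+1 t) _ _) _.
  rewrite [X in _ + X]distrC.
  have -> : 2 * b / 2 ^+ n = 2 * `|v| / 2 ^+ n / 2 * expR (L * t *+ 2)
      + 2 * b / 2 ^+ n.+1.
    by rewrite /b exprS; field; rewrite expf_neq0.
  exact: lerD.
exists (P x) => //; split => //; apply: ae_lebesgueS dy => t + t0.
by rewrite yx//; exact.
Unshelve. all: by end_near. Qed.

(** The difference solves the same equation from 0, so any bound for it on [[0, T]] can be halved
    indefinitely. Comparing the laws only before [T] lets a concatenation be matched with its first
    piece. *)
Lemma solution_unique A A' x x' T : bounded_law L A -> 0 <= T ->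
  (forall t, 0 <= t < T -> A t = A' t) ->
  solution A x -> solution A' x' -> x 0 = x' 0 ->
  forall t, 0 <= t <= T -> x t = x' t.
Proof.
move=> bA T0 AA' [acx dx] [acx' dx'] x00.
have acz t : 0 <= t -> absolutely_continuous_on 0 t (x \- x').
  by move=> t0; apply: absolutely_continuous_sub; [exact: acx|exact: acx'].
have [B B0 HB] := absolutely_continuous_bounded T0 (acz T T0).
have bound n t : 0 <= t <= T ->
    `|x t - x' t| <= B / 2 ^+ n * expR (L * t *+ 2).
  elim: n t => [|n IH] t /andP[t0 tT].
    rewrite expr0 divr1; apply: le_trans (HB t _) _; first by rewrite t0.
    by rewrite ler_peMr// -[leLHS]expR0 ler_expR mulrn_wge0// mulr_ge0.
  have -> : B / 2 ^+ n.+1 = B / 2 ^+ n / 2.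
    by rewrite exprS; field; rewrite expf_neq0.
  apply: (@growth A _ _ (x \- x') (x \- x')) => //.
  - by rewrite divr_ge0// exprn_ge0.
  - exact: acz.
  - by rewrite /= x00 subrr.
  - by move=> s /andP[s0 st]; apply: IH; rewrite s0 (le_trans st).
  - have := ae_lebesgueI dx dx'; apply: ae_lebesgueS => s [{}dx {}dx'].
    move=> /andP[/ltW s0 st]; rewrite mulmxBr; apply: is_deriveB; first exact: dx.
    by rewrite AA'; [exact: dx'|rewrite s0 (lt_le_trans st)].
move=> t tT; apply/eqP; rewrite -subr_eq0 -normr_le0.
apply: (@halves_le0 _ _ (B * expR (L * t *+ 2))) => n.
by rewrite mulrAC; exact: bound.
Qed.

End solutions.

(** * Concatenation of switching laws *)

(** A named map, so that it can carry the measurable-function structure used for the pushforward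
    measure. *)
Definition translation (R : realType) (T : R) :
  measurableTypeR R -> measurableTypeR R := fun s => s + T.

Lemma translation_measurable (R : realType) (T : R) :
  measurable_fun setT (translation T).
Proof. by apply: measurable_funD => //; exact: measurable_cst. Qed.

HB.instance Definition _ (R : realType) (T : R) :=
  isMeasurableFun.Build _ _ _ _ (translation T) (translation_measurable T).

(** Lebesgue measure is determined by its values on half-open intervals, whose lengths a translation
    preserves. *)
Lemma lebesgue_measure_translation (R : realType) (T : R) (A : set R) :
  measurable A ->
  pushforward (@lebesgue_measure R) (translation T) A = (@lebesgue_measure R) A.
Proof.
move=> mA; apply/esym/lebesgue_measure_unique => //= _ [[a b]] _ <-.
rewrite /pushforward.
have -> : translation T @^-1` `]a, b] = `](a - T), (b - T)]%classic.
  by apply/seteqP; split => x /=; rewrite /translation !in_itv /= ltrBlDr lerBrDr.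
rewrite /= !lebesgue_measure_itv /= !lte_fin ltrD2r.
by case: ifP => // _; rewrite -!EFinD; congr (_%:E); ring.
Qed.

Lemma ae_translation (R : realType) (T : R) (P : R -> Prop) :
  {ae (@lebesgue_measure R), forall t, P t} ->
  {ae (@lebesgue_measure R), forall t : R, P (t + T)}.
Proof.
move=> [N [mN N0 PN]]; exists (translation T @^-1` N); split.
- by rewrite -[X in measurable X]setTI; exact: translation_measurable.
- exact: etrans (lebesgue_measure_translation T mN) N0.
- by move=> t /= Pt; apply: PN.
Qed.

Definition concat_law (R : realType) (d : nat) (T : R) (A B : R -> 'M[R]_d) :=
  fun t => if t < T then A t else B (t - T).

Lemma concat_switching_law (R : realType) (d : nat) (cA : set 'M[R]_d) (T : R)
    (A B : R -> 'M[R]_d) : 0 <= T ->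
  switching_law cA A -> switching_law cA B ->
  switching_law cA (concat_law T A B).
Proof.
move=> T0 [mA cAA] [mB cAB]; split; last first.
  move=> t t0; rewrite /concat_law; case: ltP => [_|Tt]; first exact: cAA.
  by apply: cAB; rewrite subr_ge0.
move=> mD Y mY.
rewrite (_ : _ `&` _ = (`[0, T[ `&` (`[0, +oo[ `&` A @^-1` Y)) `|`
    (translation (- T) @^-1` (`[0, +oo[ `&` B @^-1` Y))); last first.
  apply/seteqP; split => t /=; rewrite /concat_law /translation !in_itv /= !andbT.
  - move=> [t0]; case: ltP => [tT|Tt] HY; last by right; rewrite subr_ge0.
    by left; split => //; rewrite t0.
  - move=> [[/andP[t0 tT] [_ HY]]|[tT HY]]; first by rewrite tT.
    move: tT; rewrite subr_ge0 => tT; rewrite (le_trans T0 tT).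
    by rewrite ltNge tT.
apply: measurableU; first by apply: measurableI => //; exact: mA.
rewrite -[X in measurable X]setTI; apply: translation_measurable => //.
exact: mB.
Qed.

(** No functions are glued: [z] is the solution of the concatenated law from [x 0], and uniqueness
    identifies it with [x] up to [T] and its shift by [T] with [y]. *)
Lemma solution_concat (R : realType) (d : nat) (L T : R) (A B : R -> 'M[R]_d)
    (x y : R -> 'cV[R]_d) : 0 <= L -> 0 <= T ->
  bounded_law L A -> bounded_law L B -> bounded_law L (concat_law T A B) ->
  solution A x -> solution B y -> y 0 = x T ->
  exists z, [/\ solution (concat_law T A B) z,
    forall t, 0 <= t <= T -> z t = x t &
    forall t, 0 <= t -> z (T + t) = y t].
Proof.
move=> L0 T0 bA bB bC solx soly yx.
have [z z0 solz] := solution_exists L0 (x 0) bC.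
have zx t : 0 <= t <= T -> z t = x t.
  apply: (solution_unique L0 bC T0 _ solz solx z0).
  by move=> s /andP[_ sT]; rewrite /concat_law sT.
exists z; split => // t t0; rewrite addrC.
have solzT : solution B (fun s => z (s + T)).
  have [acz dz] := solz; split.
    move=> S S0; apply: absolutely_continuous_shift; rewrite add0r.
    have := acz (S + T) (addr_ge0 S0 T0).
    move=> ac e /ac [delta d0 H]; exists delta => // n u v uv; apply: H => i.
    by have [? ? ?] := uv i; split => //; exact: le_trans T0 _.
  apply: ae_lebesgueS (ae_translation T dz) => s dzs s0.
  have := dzs (addr_ge0 s0 T0).
  (* The epsilon form of the derivative involves only differences of times, so it survives the
     shift. *)
  rewrite /concat_law ltNge lerDr s0 /= addrK => /is_derive_epsP H.
  apply/is_derive_epsP => e /H[r r0 {}H]; exists r => // u us.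
  have := H (u + T); rewrite opprD addrACA subrr addr0; exact.
have := @solution_unique _ _ L L0 B B _ y t bB t0 (fun _ _ => erefl) solzT soly.
by apply; rewrite ?add0r ?t0 ?lexx// zx// T0 lexx.
Qed.

Lemma solution_lincomb (R : realType) (d n : nat) (A : R -> 'M[R]_d)
    (c : 'I_n -> R) (x : 'I_n -> R -> 'cV[R]_d) :
  (forall k, solution A (x k)) -> solution A (fun t => \sum_k c k *: x k t).
Proof.
move=> solx; split.
  move=> T T0; apply: absolutely_continuous_lincomb => k.
  by have [+ _] := solx k; apply.
have : {ae (@lebesgue_measure R), forall t : R, forall k, 0 <= t ->
      is_derive (t : R) (1 : R) (x k) (A t *m x k t)}.
  apply: (@filter_forall _ _ _ _ (ae_filter_ringOfSetsType lebesgue_measure)).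
  by move=> k; have [] := solx k.
apply: ae_lebesgueS => t H t0.
rewrite mulmx_sumr.
have -> : (fun t => \sum_k c k *: x k t) = \sum_k (c k *: x k).
  by apply/funext => s; rewrite fct_sumE.
under [X in is_derive _ _ _ X]eq_bigr do rewrite -scalemxAr.
by apply: is_derive_sum => k; apply: is_deriveZ; exact: H.
Qed.

(** * Irreducibility *)

Lemma linear_bounded_cV (R : realType) (d : nat) (W : normedModType R)
    (f : {linear 'cV[R]_d -> W}) :
  exists2 C, 0 <= C & forall u, `|f u| <= C * `|u|.
Proof.
exists (\sum_i `|f (delta_mx i 0)|); first exact: sumr_ge0.
move=> u; rewrite [in leLHS](matrix_sum_delta u) linear_sum.
apply: le_trans (ler_norm_sum _ _ _) _; rewrite mulr_suml; apply: ler_sum => i _.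
rewrite big_ord1 linearZ /= normrZ mulrC; apply: ler_wpM2l => //.
exact: mx_norm_entry.
Qed.

(** Vectors of [S] outside the span are added one at a time; each lowers the codimension, on which
    the induction runs. *)
Lemma free_generating_subfamily (R : realType) (d : nat) (S : set 'cV[R]_d) :
  exists X : seq 'cV[R]_d, [/\ forall w, w \in X -> S w, free X &
    forall w, S w -> w \in <<X>>%VS].
Proof.
suff H k : forall X : seq 'cV[R]_d, (forall w, w \in X -> S w) -> free X ->
    (\dim (fullv : {vspace 'cV[R]_d}) - size X < k)%N ->
    exists X : seq 'cV[R]_d, [/\ forall w, w \in X -> S w, free X &
      forall w, S w -> w \in <<X>>%VS].
  by apply: (H _ [::]) => //; exact: nil_free.
elim: k => [//|k IH] X XS fX Xk.
have [[w Sw wX]|H] := pselect (exists2 w, S w & w \notin <<X>>%VS); last first.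
  exists X; split => // w Sw; apply: contrapT => /negP wX.
  by apply: H; exists w.
have fwX : free (w :: X) by rewrite free_cons wX.
apply: (IH (w :: X)) => //.
  by move=> u; rewrite inE => /orP[/eqP ->//|]; exact: XS.
have : (size (w :: X) <= \dim (fullv : {vspace 'cV[R]_d}))%N.
  by move: fwX; rewrite /free => /eqP <-; exact/dimvS/subvf.
by move=> /= h; apply: leq_trans (ltn_sub2l h _) Xk.
Qed.

(** The last hypothesis makes the span of [S] invariant; being nonzero, that span is the whole
    space. This serves both eigensets and attainable sets. *)
Lemma irreducible_basis (R : realType) (d : nat) (cA : set 'M[R]_d)
    (S : set 'cV[R]_d) : irreducible_system cA ->
  (exists2 w, S w & w != 0) ->
  (forall A w (V : {vspace 'cV[R]_d}), cA A -> S w ->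
    (forall u, S u -> u \in V) -> A *m w \in V) ->
  exists n (X : n.-tuple 'cV[R]_d),
    basis_of fullv X /\ forall i : 'I_n, S X`_i.
Proof.
move=> irr [w0 Sw0 w0n0] inv.
have [X [XS fX SX]] := free_generating_subfamily S.
have [A cAA v vX|X0|Xfull] := irr <<X>>%VS.
- rewrite (coord_span (X := in_tuple X) vX) mulmx_sumr.
  apply: memv_suml => i _; rewrite -scalemxAr memvZ//.
  by apply: (inv _ _ _ cAA) => //; apply: XS; rewrite mem_nth.
- by move: (SX _ Sw0) w0n0; rewrite X0 memv0 => ->.
exists (size X), (in_tuple X); split.
  rewrite basisEdim Xfull subvv /= -Xfull.
  by move: fX; rewrite /free => /eqP ->.
by move=> i; apply: XS; rewrite mem_nth.
Qed.

(** * Velocities and invariant subspaces *)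

Section switching.
Context (R : realType) (d : nat) (cA : set 'M[R]_d) (L : R) (L0 : 0 <= L)
  (cA_bounded : forall A, switching_law cA A -> bounded_law L A).

Lemma trajectory_exists A v : switching_law cA A ->
  exists2 x, x 0 = v & solution A x /\ trajectory cA x.
Proof.
move=> lawA; have [x x0 solx] := solution_exists L0 v (cA_bounded lawA).
by exists x => //; split => //; have [acx dx] := solx; split => //; exists A.
Qed.

Lemma constant_switching_law A : cA A -> switching_law cA (fun=> A).
Proof. by move=> cAA; split => //; exact: measurable_cst. Qed.

(** The equation holds only almost everywhere, which gives no derivative at time 0. The growth
    estimate is therefore applied to [y t - t *: (A *m y 0)], whose derivative [A *m (y t - y 0)] is
    small near 0 by continuity. *)
Lemma solution_expansion A y e : cA A -> solution (fun=> A) y -> 0 < e ->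
  exists2 h, 0 < h & `|y h - y 0 - h *: (A *m y 0)| <= e * h.
Proof.
move=> cAA [acy dy] e0.
have [_ bA] := cA_bounded (constant_switching_law cAA).
have e'0 : 0 < e / (L + 1) by rewrite divr_gt0// ltr_wpDl.
have [delta d0 H] := absolutely_continuous_uniform (acy 1 ler01) e'0.
pose h := Num.min 1 (delta / 2).
have h0 : 0 < h by rewrite lt_min ltr01 divr_gt0.
have h1 : h <= 1 by rewrite ge_min lexx.
have hd : h < delta by rewrite gt_min; apply/orP; right; lra.
exists h => //.
pose u := A *m y 0; pose f := y \- (fun t => t *: u).
have acf : absolutely_continuous_on 0 h f.
  apply: absolutely_continuous_sub; first exact/acy/ltW.
  apply: (@lipschitz_absolutely_continuous _ _ _ _ `|u|) => s t _ st _.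
  by rewrite -scalerBl normrZ mulrC ger0_norm// subr_ge0.
have -> : y h - y 0 - h *: (A *m y 0) = f h - f 0.
  by rewrite /f /= scale0r subr0 addrAC.
have -> : e * h = e * h - e * 0 by rewrite mulr0 subr0.
apply: (@absolutely_continuous_growth R d 0 h f ( *%R e) (fun=> e) (ltW h0) acf).
- by move=> s t st; rewrite ler_wpM2l// ltW.
- move=> t; apply/is_derive_epsP => e1 e10; exists 1 => // s _.
  rewrite -mulrBr -[(s - t) *: e]/((s - t) * e) [e * _]mulrC subrr normr0.
  by rewrite mulr_ge0// ltW.
- apply: ae_lebesgueS dy => t dt /andP[t0 th].
  have du : is_derive t (1 : R) (fun t => t *: u) u.
    apply/is_derive_epsP => e1 e10; exists 1 => // s _.
    by rewrite -scalerBl subrr normr0 mulr_ge0// ltW.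
  exists (A *m y t - u); first by apply: is_deriveB; exact/dt/ltW.
  rewrite /u -mulmxBr; apply: le_trans (bA 0 _ _) _ => //.
  have /ltW yt : `|y t - y 0| < e / (L + 1).
    apply: H => //; first exact: ltW.
      exact: le_trans (ltW th) h1.
    by rewrite subr0; exact: lt_trans hd.
  apply: le_trans (_ : L * (e / (L + 1)) <= _); first exact: ler_wpM2l.
  by rewrite mulrA ler_pdivrMr ?ltr_wpDl// [L * e]mulrC ler_pM2l// lerDl.
Qed.

(** The complementary projection [p] kills [y h] and [y 0]. Applied to the expansion at 0, it leaves
    only [h *: p (A *m y 0)] up to sign, of norm at most [e * h] with [e] arbitrary. *)
Lemma velocity_in_subspace A y (V : {vspace 'cV[R]_d}) : cA A ->
  solution (fun=> A) y -> (forall t, 0 <= t -> y t \in V) -> A *m y 0 \in V.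
Proof.
move=> cAA soly yV.
have [p pE] : exists p : {linear 'cV[R]_d -> 'cV[R]_d},
    forall u, p u = u - projv V u.
  exists (\1 - projv V)%VF => u; by rewrite /= add_lfunE opp_lfunE id_lfunE.
have pV u : u \in V -> p u = 0 by move=> uV; rewrite pE projv_id// subrr.
have [C C0 HC] := linear_bounded_cV p.
have pAy : p (A *m y 0) = 0.
  apply/eqP; rewrite -normr_le0; apply/ler_addgt0Pr => e e0; rewrite add0r.
  have e'0 : 0 < e / (C + 1) by rewrite divr_gt0// ltr_wpDl.
  have [h h0] := solution_expansion cAA soly e'0.
  have := HC (y h - y 0 - h *: (A *m y 0)).
  have -> : p (y h - y 0 - h *: (A *m y 0)) = - (h *: p (A *m y 0)).
    rewrite !linearB linearZ.
    by rewrite (pV _ (yV _ (ltW h0))) (pV _ (yV _ (lexx _))) subrr sub0r.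
  rewrite normrN normrZ.
  rewrite gtr0_norm// => H1 H2.
  rewrite -(ler_pM2l h0); apply: le_trans H1 _.
  apply: le_trans (ler_wpM2l C0 H2) _.
  rewrite [leLHS]mulrA [leRHS]mulrC ler_pM2r// mulrA ler_pdivrMr ?ltr_wpDl//.
  by rewrite [C * e]mulrC ler_pM2l// lerDl.
have -> : A *m y 0 = projv V (A *m y 0).
  by apply/eqP; rewrite -subr_eq0 -pE pAy.
exact: memv_proj.
Qed.

(** The law and its solution are explicit and the time is free, so that a path can be prolonged by
    concatenation. *)
Definition attainable (v : 'cV[R]_d) : set 'cV[R]_d :=
  [set w | exists A x t, [/\ switching_law cA A, solution A x, x 0 = v, 0 <= t &
    x t = w]].

(** A path reaching [w], prolonged by the constant law [A], visits attainable points only, so a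
    subspace containing all of these contains the velocity [A *m w]. *)
Lemma attainable_basis v : cA !=set0 -> irreducible_system cA -> v != 0 ->
  exists n (X : n.-tuple 'cV[R]_d),
    basis_of fullv X /\ forall i : 'I_n, attainable v X`_i.
Proof.
move=> [A0 cAA0] irr v0; apply: irreducible_basis (irr) _ _.
  have lawA0 := constant_switching_law cAA0.
  have [x x0 [solx _]] := trajectory_exists v lawA0.
  by exists v => //; exists (fun=> A0), x, 0; split.
move=> A w V cAA [B [x [t [lawB solx x0 t0 xt]]]] SV.
have lawA := constant_switching_law cAA.
have [y y0 [soly _]] := trajectory_exists w lawA.
rewrite -y0; apply: (velocity_in_subspace cAA soly) => s s0; apply: SV.
have lawC := concat_switching_law t0 lawB lawA.
have [|z [solz zx zy]] := solution_concat L0 t0 (cA_bounded lawB)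
  (cA_bounded lawA) (cA_bounded lawC) solx soly; first by rewrite y0 xt.
exists (concat_law t B (fun=> A)), z, (t + s); split => //.
- by rewrite zx ?x0// t0 lexx.
- exact: addr_ge0.
- exact: zy.
Qed.

Lemma eigenset_neq0 M alpha : eigenset cA M alpha -> exists2 m, M m & m != 0.
Proof.
move=> [_ [m Mm] Mn0 _]; apply: contrapT => H; apply: Mn0.
have M0 w : M w -> w = 0.
  by move=> Mw; apply: contrapT => /eqP w0; apply: H; exists w.
by apply/seteqP; split => [w /M0 //|w /= ->]; rewrite -(M0 m Mm).
Qed.

(** A trajectory from [M] stays in multiples of [M], hence in every subspace containing [M], and so
    does its initial velocity. *)
Lemma eigenset_basis M alpha : irreducible_system cA -> eigenset cA M alpha ->
  exists n (X : n.-tuple 'cV[R]_d),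
    basis_of fullv X /\ forall i : 'I_n, M X`_i.
Proof.
move=> irr eM; have [_ _ _ HM] := eM.
apply: irreducible_basis (irr) (eigenset_neq0 eM) _.
move=> A w V cAA Mw MV.
have [y y0 [soly trajy]] := trajectory_exists w (constant_switching_law cAA).
rewrite -y0; apply: (velocity_in_subspace cAA soly) => t t0.
have : reachable cA M t (y t) by exists y; split => //; rewrite y0.
by rewrite HM// => -[u Mu <-]; rewrite memvZ// MV.
Qed.

End switching.

(** * The eigenvalue is the Lyapunov exponent *)

Section eigenvalue.
Context (R : realType) (d : nat) (cA : set 'M[R]_d) (L : R) (L0 : 0 <= L)
  (cA_bounded : forall A, switching_law cA A -> bounded_law L A)
  (cA_irreducible : irreducible_system cA) (cA_neq0 : cA !=set0).

Lemma solution_coordE n (X : n.-tuple 'cV[R]_d) A x (y : 'I_n -> R -> 'cV[R]_d) :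
  basis_of fullv X -> switching_law cA A -> solution A x ->
  (forall i, y i 0 = X`_i) -> (forall i, solution A (y i)) ->
  forall t, 0 <= t -> x t = \sum_i coord X i (x 0) *: y i t.
Proof.
move=> bX lawA solx y0 soly t t0.
have solz := solution_lincomb (fun i => coord X i (x 0)) soly.
have bA := cA_bounded lawA.
apply: (solution_unique L0 bA t0 _ solx solz); rewrite ?t0 ?lexx//.
under eq_bigr do rewrite y0.
exact: (coord_basis bX (memvf _)).
Qed.

Lemma eigenset_bounded M alpha : eigenset cA M alpha ->
  exists2 K, 0 <= K & (forall m, M m -> `|m| <= K) /\
  forall x, trajectory cA x -> M (x 0) ->
    forall t, 0 <= t -> `|x t| <= K * expR (alpha * t).
Proof.
move=> [cM _ _ HM]; have [K [_ HK]] := compact_bounded cM.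
have {}HK m : M m -> `|m| <= `|K| + 1.
  by move=> /HK; apply; have := ler_norm K; lra.
exists (`|K| + 1); first exact: addr_ge0.
split => // x trajx Mx0 t t0.
have : reachable cA M t (x t) by exists x.
rewrite HM// => -[m Mm <-].
by rewrite normrZ gtr0_norm ?expR_gt0// mulrC ler_pM2r ?expR_gt0// HK.
Qed.

Lemma trajectory_growth M alpha x : eigenset cA M alpha -> trajectory cA x ->
  exists C : R, forall t, 0 <= t -> `|x t| <= C * expR (alpha * t).
Proof.
move=> eM [acx [A lawA dx]].
have [n [X [bX XM]]] := eigenset_basis L0 cA_bounded cA_irreducible eM.
have [K K0 [_ HK]] := eigenset_bounded eM.
(* The basis solutions follow the same law as [x], and each starts in [M]. *)
have yex (i : 'I_n) : exists y, [/\ y 0 = X`_i, solution A y & trajectory cA y].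
  by have [y ? []] := trajectory_exists L0 cA_bounded X`_i lawA; exists y.
have [y Hy] := choice yex.
exists (\sum_i `|coord X i (x 0)| * K) => t t0.
have y0 i : y i 0 = X`_i by have [] := Hy i.
have soly i : solution A (y i) by have [] := Hy i.
rewrite (solution_coordE bX lawA (conj acx dx) y0 soly t0).
apply: le_trans (ler_norm_sum _ _ _) _; rewrite mulr_suml; apply: ler_sum => i _.
rewrite normrZ -mulrA ler_wpM2l//; have [yi0 _ trajy] := Hy i.
by apply: HK => //; rewrite yi0.
Qed.

(* Write the starting point in M of a trajectory that ends at
   exp(alpha t) m in a basis attainable from v: one of the basis vectors must
   grow like exp(alpha t) under the same law. *)
Lemma trajectory_escape M alpha beta k v : eigenset cA M alpha ->
  beta < alpha -> v != 0 ->
  exists B y S, [/\ switching_law cA B, solution B y, y 0 = v, 1 <= S &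
    k * expR (beta * S) <= `|y S|].
Proof.
move=> eM ba v0; apply: contrapT => Hn.
(* Otherwise every solution from [v] stays below [k * expR (beta * S)] from time 1 on. *)
have {}Hn B y S : switching_law cA B -> solution B y -> y 0 = v -> 1 <= S ->
    `|y S| <= k * expR (beta * S).
  move=> lawB soly y0 S1; rewrite leNgt; apply/negP => H.
  by apply: Hn; exists B, y, S; split => //; exact: ltW.
have [n [X [bX Xv]]] := attainable_basis L0 cA_bounded cA_neq0 cA_irreducible v0.
have Xv' (i : 'I_n) : exists p : (R -> 'M[R]_d) * (R -> 'cV[R]_d) * R,
    [/\ switching_law cA p.1.1, solution p.1.1 p.1.2, p.1.2 0 = v, 0 <= p.2 &
     p.1.2 p.2 = X`_i].
  by have [A [x [t H]]] := Xv i; exists (A, x, t).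
have [p Hp] := choice Xv'.
have [K K0 [HK _]] := eigenset_bounded eM.
have coordb (i : 'I_n) : exists C, 0 <= C /\ forall u, `|coord X i u| <= C * `|u|.
  by have [C C0 HC] := @linear_bounded_cV R d R^o (coord X i); exists C.
have [C HC] := choice coordb.
have [m Mm m0] := eigenset_neq0 eM.
(* Each term multiplies a bound on the [i]-th coordinate over [M] by the factor due to the time
   [(p i).2] spent in reaching the [i]-th basis vector from [v]. *)
pose D := \sum_i C i * K * (k * expR (beta * (p i).2)).
have key (t : R) : 1 <= t -> expR (alpha * t) * `|m| <= D * expR (beta * t).
  move=> t1; have t0 : 0 <= t by exact: le_trans t1.
  have : reachable cA M t (expR (alpha * t) *: m).
    by have [_ _ _ ->//] := eM; exists m.
  move=> [x [[acx [A lawA dx]] Mx0 xt]].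
  have yex (i : 'I_n) : exists y, y 0 = X`_i /\ solution A y.
    by have [y ? []] := trajectory_exists L0 cA_bounded X`_i lawA; exists y.
  have [y Hy] := choice yex.
  have -> : expR (alpha * t) * `|m| = `|x t|.
    by rewrite xt normrZ gtr0_norm// expR_gt0.
  have y0 i : y i 0 = X`_i by have [] := Hy i.
  have soly i : solution A (y i) by have [] := Hy i.
  rewrite (solution_coordE bX lawA (conj acx dx) y0 soly t0).
  apply: le_trans (ler_norm_sum _ _ _) _; rewrite mulr_suml; apply: ler_sum => i _.
  rewrite normrZ -mulrA; have [C0 Cb] := HC i.
  apply: ler_pM => //.
    by apply: le_trans (Cb _) _; apply: ler_wpM2l => //; exact: HK.
  (* The solution from the basis vector prolongs the path from [v], so [Hn] bounds it at total time
     [(p i).2 + t]. *)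
  have [lawp solp p0 pt0 pX] := Hp i; have [yi0 solyi] := Hy i.
  have lawC := concat_switching_law pt0 lawp lawA.
  have [|z [solz zx zy]] := solution_concat L0 pt0 (cA_bounded lawp)
    (cA_bounded lawA) (cA_bounded lawC) solp solyi; first by rewrite yi0 pX.
  rewrite -(zy t t0) -mulrA -expRD -mulrDr; apply: (Hn _ _ _ lawC solz).
    by rewrite zx ?p0// pt0 lexx.
  by rewrite ler_wpDl.
have gap : 0 < alpha - beta by rewrite subr_gt0.
have m_gt0 : 0 < `|m| by rewrite normr_gt0.
(* With this [t], the product of [alpha - beta], [t] and the norm of [m] exceeds the absolute value
   of [D], so [1 + x <= expR x] contradicts [key]; the added 1 ensures [1 <= t]. *)
pose t := `|D| / (`|m| * (alpha - beta)) + 1.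
have t1 : 1 <= t by rewrite /t lerDr divr_ge0// mulr_ge0// ltW.
have := key t t1; apply/negP; rewrite -ltNge.
have -> : alpha * t = (alpha - beta) * t + beta * t by ring.
rewrite expRD mulrAC ltr_pM2r ?expR_gt0//.
apply: le_lt_trans (ler_norm D) _.
apply: lt_le_trans (_ : (1 + (alpha - beta) * t) * `|m| <= _); last first.
  by rewrite ler_pM2r// expR_ge1Dx.
have -> : (1 + (alpha - beta) * t) * `|m| = `|m| + `|D| + (alpha - beta) * `|m|.
  by rewrite /t; field; rewrite !lt0r_neq0.
have : 0 < (alpha - beta) * `|m| by rewrite mulr_gt0.
by lra.
Qed.

Lemma unbounded_trajectory M alpha beta : eigenset cA M alpha -> beta < alpha ->
  exists2 x, trajectory cA x &
    forall C : R, exists2 t, 0 <= t & C * expR (beta * t) < `|x t|.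
Proof.
move=> eM ba.
have [m _ m0] := eigenset_neq0 eM.
(* A state is a law, its solution and a stopping time. The nonzero endpoint required by [good]
   permits the next escape. *)
pose state := ((R -> 'M[R]_d) * (R -> 'cV[R]_d) * R)%type.
pose good (s : state) := [/\ switching_law cA s.1.1, solution s.1.1 s.1.2,
  s.1.2 0 = m, 0 <= s.2 & s.1.2 s.2 != 0].
(* The law is kept before the old stopping time. Stopping times grow by at least 1, so the factor
   [s.2 + 1] tends to infinity. *)
pose next (s s' : state) := [/\ good s', s.2 + 1 <= s'.2,
  forall t, t < s.2 -> s'.1.1 t = s.1.1 t &
  (s.2 + 1) * expR (beta * s'.2) <= `|s'.1.2 s'.2|].
have stepE s : exists s', good s -> next s s'.
  have [gs|ngs] := pselect (good s); last by exists s.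
  have [lawA solx x0 T0 xT] := gs.
  (* The factor [expR (beta * s.2)] accounts for the time already elapsed. *)
  have [B [y [S [lawB soly y0 S1 HS]]]] :=
    @trajectory_escape M alpha beta ((s.2 + 1) * expR (beta * s.2)) _ eM ba xT.
  have lawC := concat_switching_law T0 lawA lawB.
  have [z [solz zx zy]] := solution_concat L0 T0 (cA_bounded lawA)
    (cA_bounded lawB) (cA_bounded lawC) solx soly y0.
  have S0 : 0 <= S by exact: le_trans S1.
  have growth : (s.2 + 1) * expR (beta * (s.2 + S)) <= `|z (s.2 + S)|.
    by rewrite zy// mulrDr expRD mulrA.
  exists (concat_law s.2 s.1.1 B, z, s.2 + S) => _; split => //=.
  - split => //=; first by rewrite zx ?x0// T0 lexx.
      exact: addr_ge0.
    rewrite -normr_gt0; apply: lt_le_trans growth.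
    by rewrite mulr_gt0 ?expR_gt0// ltr_wpDl.
  - by rewrite lerD2l.
  - by move=> t tT; rewrite /concat_law tT.
have [F HF] := choice stepE.
have [A0 cAA0] := cA_neq0.
have lawA0 := constant_switching_law cAA0.
have [x0 x00 [solx0 _]] := trajectory_exists L0 cA_bounded m lawA0.
pose s n := iter n F ((fun=> A0), x0, 0 : R).
have gs n : good (s n).
  elim: n => [|n IH]; first by split => //=; rewrite x00.
  by have [] := HF _ IH.
have sS n : next (s n) (s n.+1) by exact: HF.
have sT n : n%:R <= (s n).2.
  elim: n => [|n IH]; first exact: lexx.
  by have [_ + _ _] := sS n; rewrite -natr1; apply: le_trans; rewrite lerD2r.
have sT_mono n k : (n <= k)%N -> (s n).2 <= (s k).2.
  move=> /subnK <-; elim: (k - n)%N => [|j IH]; first exact: lexx.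
  by apply: le_trans IH _; have [_ + _ _] := sS (j + n)%N; rewrite addSn; lra.
have agree n k t : (n <= k)%N -> t < (s n).2 -> (s k).1.1 t = (s n).1.1 t.
  move=> /subnK <- tn; elim: (k - n)%N => [//|j IH].
  rewrite addSn; have [_ _ + _] := sS (j + n)%N => -> //.
  by apply: lt_le_trans tn _; apply: sT_mono; exact: leq_addl.
(* The law s n is final on [0, n[, because (s n).2 >= n. *)
pose B t := (s (Num.truncn t).+1).1.1 t.
have trunc t : 0 <= t -> t < (s (Num.truncn t).+1).2.
  by move=> t0; apply: lt_le_trans (sT _); have /andP[] := truncn_itv t0.
have BE n t : 0 <= t < (s n).2 -> B t = (s n).1.1 t.
  move=> /andP[t0 tn]; rewrite /B.
  have [nt|tn'] := leqP n (Num.truncn t).+1; first exact: agree.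
  by apply/esym/agree; [exact: ltnW|exact: trunc].
have lawB : switching_law cA B.
  split; last by move=> t t0; have [[_ +] _ _ _ _] := gs (Num.truncn t).+1; apply.
  move=> mD Y mY.
  (* On [[n, n + 1[] the law [B] is the single measurable law of [s n.+1]. *)
  rewrite (_ : _ `&` _ = \bigcup_n (`[n%:R, n.+1%:R[ `&`
      (`[0, +oo[ `&` (s n.+1).1.1 @^-1` Y))); last first.
    apply/seteqP; split => t /=.
    - rewrite in_itv /= andbT => -[t0 Yt]; exists (Num.truncn t) => //.
      by split; rewrite /= in_itv /= ?andbT//; exact: truncn_itv.
    - move=> [n _ [/= tn [t0 Yt]]]; split => //.
      by rewrite /B (truncn_def (n := n)).
  apply: bigcupT_measurable => n; apply: measurableI => //.
  by have [[mAn _] _ _ _ _] := gs n.+1; exact: mAn.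
have [x xm [solx trajx]] := trajectory_exists L0 cA_bounded m lawB.
exists x => // C.
have [_ _ _ T0 _] := gs (Num.bound `|C|).+1.
exists (s (Num.bound `|C|).+1).2 => //.
(* The laws agree before the stopping time, so by uniqueness the solutions agree up to and including
   it. *)
have -> : x (s (Num.bound `|C|).+1).2 = (s (Num.bound `|C|).+1).1.2 (s (Num.bound `|C|).+1).2.
  have [_ soln xn _ _] := gs (Num.bound `|C|).+1.
  apply: (solution_unique L0 (cA_bounded lawB) T0 _ solx soln).
  - by move=> t; exact: BE.
  - by rewrite xm xn.
  - by rewrite T0 lexx.
(* The previous stopping time is at least its index, which exceeds the absolute value of [C]; hence
   the factor in [next] exceeds [C]. *)
have [_ _ _] := sS (Num.bound `|C|); apply: lt_le_trans.
rewrite ltr_pM2r ?expR_gt0//.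
have := sT (Num.bound `|C|); have := ler_norm C.
have := archi_boundP (normr_ge0 C).
by lra.
Qed.

End eigenvalue.

Theorem theorem1 (R : realType) (d : nat) (cA : set 'M[R]_d)
    (hA : switching_system cA) (hirr : irreducible_system cA)
    (M : set 'cV[R]_d) (alpha : R) (hM : eigenset cA M alpha) :
  alpha%:E = lyapunov_exponent cA.
Proof.
have [cA_neq0 cA_compact _ _] := hA.
have [L L0 cA_bounded] := switching_law_bounded cA_compact.
apply/eqP; rewrite eq_le; apply/andP; split.
(* No [beta] below [alpha] is an admissible exponent. *)
- apply: le_ereal_inf_tmp => _ [beta Hbeta <-]; rewrite lee_fin leNgt; apply/negP => ba.
  have [x trajx Hx] := unbounded_trajectory L0 cA_bounded hirr cA_neq0 hM ba.
  have [C HC] := Hbeta x trajx; have [t t0] := Hx C.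
  by rewrite ltNge HC.
(* The exponent [alpha] itself is admissible. *)
- apply: ereal_inf_lbound; exists alpha => // x trajx.
  exact: trajectory_growth L0 cA_bounded hirr _ _ _ hM trajx.
Qed.
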